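(* In the Robertson–Webb query model there is no protocol that, for every cake-division instance with market valuation, finds with finitely many queries (to the subjective utility measures and the market measure) an allocation that is envy-free both with respect to the subjective utilities and with respect to the market valuation.
   Context: The cake is the interval $[0,1]$; a piece is a Borel subset of $[0,1]$. A density function is an integrable $f:[0,1]\to\mathbb{R}_{\ge0}$, and the value of a piece $X$ is $f(X)=\int_X f(x)\,dx$; values are normalized so that $f([0,1])=1$. A cake-division instance consists of $n$ agents with subjective density functions $u_1,\dots,u_n$ and a market density function $v$. An allocation $A=(A_1,\dots,A_n)$ is a partition of $[0,1]$ into $n$ pieces, pairwise disjoint up to overlaps of Lebesgue measure zero, with $A_i$ given to agent $i$. $A$ is envy-free (EF) with respect to the subjective utilities if $u_i(A_i)\ge u_i(A_j)$ for all agents $i,j$, and EF with respect to the market valuation if $v(A_i)=v(A_j)$ for all $i,j$. Robertson–Webb query model: a (deterministic) protocol accesses each measure $f\in\{u_1,\dots,u_n,v\}$ only through adaptively chosen queries of two types: an evaluation query, which for given $0\le x\le y\le1$ returns $f([x,y])$; and a cut query, which for given $x\in[0,1]$ and $\beta\ge0$ returns a point $y\in[x,1]$ with $f([x,y])=\beta$ (or reports that none exists). After finitely many queries the protocol must output an allocation that depends only on the answers received. *)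

(* Defs.v *)
From HB Require Import structures.
From mathcomp Require Import all_boot all_order all_algebra.
From mathcomp Require Import all_classical all_reals all_analysis.
Set Implicit Arguments.
Unset Strict Implicit.
Unset Printing Implicit Defensive.
Import Order.TTheory GRing.Theory Num.Theory.
Import numFieldNormedType.Exports.
Local Open Scope classical_set_scope.
Local Open Scope ring_scope.

Definition cake {R : realType} : set R := `[0, 1].

Definition value {R : realType} (f : R -> R) (X : set R) : R :=
  \int[lebesgue_measure]_(x in X) f x.

(* Density functions on the cake are functions on R of which only the values
   on [0, 1] are constrained; they are normalized to total value 1. *)
Definition density {R : realType} (f : R -> R) : Prop :=
  [/\ lebesgue_measure.-integrable cake (EFin \o f),
      forall x, x \in (cake : set R) -> 0 <= f x
    & value f cake = 1].

Record instance (R : realType) (n : nat) := Instance {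
  utility : 'I_n -> R -> R;
  market : R -> R;
  utility_density : forall i, density (utility i);
  market_density : density market }.

(* The measurable sets of measurableTypeR R are the Borel subsets of R. *)
Definition is_allocation {R : realType} {n : nat} (A : 'I_n -> set R) : Prop :=
  [/\ forall i, measurable (A i : set (measurableTypeR R)),
      \bigcup_(i in [set: 'I_n]) A i = cake
    & forall i j, i != j -> lebesgue_measure (A i `&` A j) = 0%E].

Definition envy_free {R : realType} {n : nat} (I : instance R n)
    (A : 'I_n -> set R) : Prop :=
  forall i j, value (utility I i) (A j) <= value (utility I i) (A i).

Definition market_envy_free {R : realType} {n : nat} (I : instance R n)
    (A : 'I_n -> set R) : Prop :=
  forall i j, value (market I) (A i) = value (market I) (A j).

(* A query addresses the utility of agent i (Some i) or the market (None). *)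
Inductive query (R : realType) (n : nat) :=
| Eval (m : option 'I_n) (x y : R) of 0 <= x & x <= y & y <= 1
| Cut (m : option 'I_n) (x beta : R) of 0 <= x & x <= 1 & 0 <= beta.

(* None is the reply to a cut query that has no solution. *)
Definition answer (R : realType) := option R.

(* A deterministic protocol maps the answers received so far, oldest first,
   to the next query or to an output. *)
Definition protocol (R : realType) (n : nat) :=
  seq (answer R) -> query R n + ('I_n -> set R).

(* When f vanishes on an interval, a cut query can have several correct
   replies; a cut oracle is any rule that selects one of them. *)
Definition cut_oracle {R : realType} (cut : (R -> R) -> R -> R -> answer R) :
    Prop :=
  forall f x beta, density f -> 0 <= x -> x <= 1 -> 0 <= beta ->
    match cut f x beta with
    | Some y => [/\ x <= y, y <= 1 & value f `[x, y] = beta]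
    | None => forall y, x <= y -> y <= 1 -> value f `[x, y] <> beta
    end.

Definition measure_of {R : realType} {n : nat} (I : instance R n)
    (m : option 'I_n) : R -> R :=
  if m is Some i then utility I i else market I.

Definition reply {R : realType} {n : nat}
    (cut : (R -> R) -> R -> R -> answer R) (I : instance R n)
    (q : query R n) : answer R :=
  match q with
  | Eval m x y _ _ _ => Some (value (measure_of I m) `[x, y])
  | Cut m x beta _ _ _ => cut (measure_of I m) x beta
  end.

(* outputs P ans h A: after the answers h, the protocol P outputs A after
   finitely many further queries, answered by ans. *)
Inductive outputs {R : realType} {n : nat} (P : protocol R n)
    (ans : query R n -> answer R) : seq (answer R) -> ('I_n -> set R) -> Prop :=
| outputs_stop h A : P h = inr A -> outputs P ans h A
| outputs_query h q A :
    P h = inl q -> outputs P ans (rcons h (ans q)) A -> outputs P ans h A.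

(* Main.v *)
(* Take two agents with uniform utilities: an allocation that is fair in both
   senses gives the first agent length 1/2 and market value 1/2. An adversary
   invents the market while answering. It keeps track of the points
   (x, market value of [0, x]) revealed so far and chooses each new one
   generically, so that (1/2, 1/2) never lies in the subgroup of R^2 they
   generate; in particular no union of cells between revealed points halves both
   length and market value. Each answer perturbs the market density by a
   geometrically decreasing amount, so the densities converge uniformly and the
   limit is a single instance compatible with all the answers, on which the
   protocol has to halt with some allocation. The first share must be a union of
   cells up to a null set, since otherwise the market could be changed inside a
   cell, without changing any answer, so as to spoil its value 1/2. Hence
   (1/2, 1/2) is in the subgroup, a contradiction. *)
Require Import Defs.
From HB Require Import structures.
From mathcomp Require Import all_boot all_order all_algebra.
From mathcomp Require Import all_classical all_reals all_analysis.
From mathcomp Require Import measurable_realfun zify ring lra.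
Import Order.TTheory GRing.Theory Num.Theory.
Import numFieldNormedType.Exports.
Local Open Scope classical_set_scope.
Local Open Scope ring_scope.

(** * Bounded measurable functions on the cake *)

Definition bounded_measurable {R : realType} (f : R -> R) : Prop :=
  measurable_fun [set: R] f /\ exists M : R, forall x, `|f x| <= M.

Definition mass {R : realType} (f : R -> R) (x : R) : R := value f `[0, x].

Definition piece {R : realType} (X : set R) : Prop :=
  measurable (X : set (measurableTypeR R)) /\ X `<=` cake.

Definition len {R : realType} (X : set R) : R := fine (lebesgue_measure X).

Lemma piece_itv (R : realType) (b c : bool) (x y : R) : 0 <= x -> y <= 1 ->
  piece [set` Interval (BSide b x) (BSide c y)].
Proof.
move=> x0 y1; split; first exact: measurable_itv.
move=> z; rewrite /cake /= !in_itv /= => /andP[].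
by case: b; case: c => /= xz zy; apply/andP; split;
  rewrite ?(le_trans x0) ?(le_trans _ y1) // ltW.
Qed.

Lemma piece_cake (R : realType) : piece (@cake R).
Proof. exact: piece_itv. Qed.

Lemma pieceI (R : realType) (X Y : set R) :
  piece X -> measurable (Y : set (measurableTypeR R)) -> piece (X `&` Y).
Proof. by move=> [mX sX] mY; split; [exact: measurableI | move=> x [/sX]]. Qed.

Lemma pieceD (R : realType) (X Y : set R) :
  piece X -> measurable (Y : set (measurableTypeR R)) -> piece (X `\` Y).
Proof. by move=> [mX sX] mY; split; [exact: measurableD | move=> x [/sX]]. Qed.

Lemma lebesgue_cake (R : realType) : lebesgue_measure (@cake R) = 1%E.
Proof. by rewrite /cake lebesgue_measure_itv /= lte_fin ltr01 oppr0 adde0. Qed.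

Lemma piece_finite (R : realType) (X : set R) : piece X ->
  lebesgue_measure X \is a fin_num.
Proof.
move=> [mX sX]; rewrite ge0_fin_numE //; apply: (@le_lt_trans _ _ 1%E) => //.
  by rewrite -(lebesgue_cake R); apply: le_measure => //; rewrite inE //;
     exact: (proj1 (piece_cake R)).
by rewrite ltey.
Qed.

Lemma bounded_measurable_integrable (R : realType) (f : R -> R) (X : set R) :
  bounded_measurable f -> piece X ->
  lebesgue_measure.-integrable X (EFin \o f).
Proof.
move=> [mf [M fM]] pX; apply: measurable_bounded_integrable.
- exact: pX.1.
- by rewrite -ge0_fin_numE //; exact: piece_finite.
- exact: measurable_funS mf.
- exists M; split; first exact: num_real.
  by move=> x Mx y _ /=; exact: le_trans (fM y) (ltW Mx).
Qed.

Lemma value_split (R : realType) (f : R -> R) (X C : set R) :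
  bounded_measurable f -> piece X -> measurable (C : set (measurableTypeR R)) ->
  value f X = value f (X `&` C) + value f (X `\` C).
Proof.
move=> bf pX mC; rewrite /value -[in LHS](setUIDK X C).
rewrite Rintegral_setU //.
- by apply: measurableI => //; exact: pX.1.
- by apply: measurableD => //; exact: pX.1.
- by rewrite setUIDK; exact: bounded_measurable_integrable.
- by apply/disj_setPS => x [] [_ ?] [].
Qed.

Lemma value_lin (R : realType) (f g : R -> R) (e : R) (X : set R) :
  bounded_measurable f -> bounded_measurable g -> piece X ->
  value (fun x => f x + e * g x) X = value f X + e * value g X.
Proof.
move=> bf bg pX; rewrite /value RintegralD //=; last 3 first.
- exact: pX.1.
- exact: bounded_measurable_integrable.
- have := bounded_measurable_integrable _ _ _ bg pX.
  by move=> /(integrableZl pX.1 e); apply: eq_integrable => //; exact: pX.1.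
by rewrite RintegralZl //; [exact: pX.1 | exact: bounded_measurable_integrable].
Qed.

Lemma value_cst (R : realType) (c : R) (X : set R) : piece X ->
  value (fun=> c) X = c * len X.
Proof. by move=> pX; rewrite /value Rintegral_cst //; exact: pX.1. Qed.

Lemma bounded_measurable_cst (R : realType) (c : R) :
  bounded_measurable (fun _ : R => c).
Proof. by split; [exact: measurable_cst | exists `|c|]. Qed.

Lemma bounded_measurable_lin (R : realType) (f g : R -> R) (e : R) :
  bounded_measurable f -> bounded_measurable g ->
  bounded_measurable (fun x => f x + e * g x).
Proof.
move=> [mf [M fM]] [mg [N gN]]; split.
  by apply: measurable_funD => //; exact: measurable_funM.
exists (M + `|e| * N) => x; rewrite (le_trans (ler_normD _ _)) // lerD //.
by rewrite normrM ler_wpM2l.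
Qed.

Lemma le_value (R : realType) (f g : R -> R) (X : set R) :
  bounded_measurable f -> bounded_measurable g -> piece X ->
  (forall x, f x <= g x) -> value f X <= value g X.
Proof.
move=> bf bg pX fg; apply: le_Rintegral => //; first exact: pX.1.
  exact: bounded_measurable_integrable.
exact: bounded_measurable_integrable.
Qed.

Lemma len_le1 (R : realType) (X : set R) : piece X -> len X <= 1.
Proof.
move=> pX; rewrite /len -lee_fin fineK ?piece_finite // -(lebesgue_cake R).
by apply: le_measure; rewrite ?inE; [exact: pX.1|exact: (piece_cake R).1|exact: pX.2].
Qed.

Lemma value_dist (R : realType) (f g : R -> R) (e : R) (X : set R) :
  bounded_measurable f -> bounded_measurable g -> piece X -> 0 <= e ->
  (forall x, `|f x - g x| <= e) -> `|value f X - value g X| <= e.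
Proof.
move=> bf bg pX e0 fg.
have b1 := bounded_measurable_cst _ (1 : R).
have v1 : value (fun=> 1) X = len X by rewrite value_cst // mul1r.
have H1 : value f X <= value g X + e * len X.
  rewrite -v1 -value_lin //; apply: le_value => //.
    exact: bounded_measurable_lin.
  by move=> x; have := fg x; rewrite ler_norml mulr1; lra.
have H2 : value g X <= value f X + e * len X.
  rewrite -v1 -value_lin //; apply: le_value => //.
    exact: bounded_measurable_lin.
  by move=> x; have := fg x; rewrite ler_norml mulr1; lra.
have : e * len X <= e by rewrite ler_piMr // len_le1.
by rewrite ler_norml; lra.
Qed.

Lemma value_interval (R : realType) (f : R -> R) (x y : R) :
  bounded_measurable f -> 0 <= x -> x <= y -> y <= 1 ->
  value f `[x, y] = mass f y - mass f x.
Proof.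
move=> bf x0 xy y1; rewrite /mass /value Rintegral_itvB ?bnd_simp //; last first.
  by apply: bounded_measurable_integrable => //; exact: piece_itv.
rewrite Rintegral_itv_obnd_cbnd //.
by apply: bounded_measurable_integrable => //; exact: piece_itv.
Qed.

Lemma len_itv (R : realType) (x y : R) : x <= y -> len `[x, y] = y - x.
Proof.
rewrite /len lebesgue_measure_itv /= lte_fin le_eqVlt => /predU1P[->|xy].
  by rewrite ltxx subrr.
by rewrite xy.
Qed.

Lemma len0 (R : realType) : len (@set0 R) = 0.
Proof. by rewrite /len measure0. Qed.

Lemma len_ge0 (R : realType) (X : set R) : 0 <= len X.
Proof. by rewrite /len fine_ge0. Qed.

Lemma len_split (R : realType) (X C : set R) :
  piece X -> measurable (C : set (measurableTypeR R)) ->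
  len X = len (X `&` C) + len (X `\` C).
Proof.
move=> pX mC.
have := value_split _ _ _ _ (bounded_measurable_cst R 1) pX mC.
by rewrite !value_cst ?mul1r; do ?[exact: pieceI | exact: pieceD].
Qed.

(** [f] lies between the constants [- M] and [M], whose values on a piece of length zero vanish. *)
Lemma value_null (R : realType) (f : R -> R) (X : set R) :
  bounded_measurable f -> piece X -> len X = 0 -> value f X = 0.
Proof.
move=> [mf [M fM]] pX X0.
have bf : bounded_measurable f by split => //; exists M.
have H (s : R) : value (fun x => s + 0 * f x) X = 0.
  by rewrite value_lin // ?mul0r ?addr0 ?value_cst ?X0 ?mulr0 //;
    exact: bounded_measurable_cst.
have B (s : R) : bounded_measurable (fun x => s + 0 * f x).
  by apply: bounded_measurable_lin => //; exact: bounded_measurable_cst.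
apply/eqP; rewrite eq_le; apply/andP; split.
  rewrite -(H M); apply: le_value => // x.
  by have := fM x; rewrite ler_norml mul0r; lra.
rewrite -(H (- M)); apply: le_value => // x.
by have := fM x; rewrite ler_norml mul0r; lra.
Qed.

(** * Moving value inside a cell *)

Lemma bounded_measurable_indic (R : realType) (Y : set R) :
  measurable (Y : set (measurableTypeR R)) ->
  bounded_measurable (\1_Y : R -> R).
Proof.
move=> mY; split; first exact: measurable_indic.
by exists 1 => x; rewrite indicE; case: (x \in Y); rewrite ?normr1 ?normr0.
Qed.

Lemma value_indic (R : realType) (X Y : set R) :
  piece X -> measurable (Y : set (measurableTypeR R)) ->
  value (\1_Y : R -> R) X = len (X `&` Y).
Proof.
move=> pX mY; rewrite /value /Rintegral integral_indic //; last exact: pX.1.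
by rewrite setIC.
Qed.

(* Adding a multiple of [tilt C A] to a density moves value between
   [C `&` A] and [C `\` A] and leaves the value of [C] unchanged. *)
Definition tilt {R : realType} (C A : set R) : R -> R :=
  fun x => (0 + len (C `\` A) * \1_(C `&` A) x) +
           (- len (C `&` A)) * \1_(C `\` A) x.

Lemma value_tilt (R : realType) (C A X : set R) :
  measurable (C : set (measurableTypeR R)) ->
  measurable (A : set (measurableTypeR R)) -> piece X ->
  value (tilt C A) X = len (C `\` A) * len (X `&` (C `&` A))
    - len (C `&` A) * len (X `&` (C `\` A)).
Proof.
move=> mC mA pX.
have mI : measurable (C `&` A : set (measurableTypeR R)) by exact: measurableI.
have mD : measurable (C `\` A : set (measurableTypeR R)) by exact: measurableD.
have b0 := bounded_measurable_cst R 0.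
have bI := bounded_measurable_indic _ _ mI.
have bD := bounded_measurable_indic _ _ mD.
rewrite value_lin // ?value_lin ?value_indic ?value_cst //.
  by rewrite mul0r add0r mulNr.
exact: bounded_measurable_lin.
Qed.

Lemma bounded_measurable_tilt (R : realType) (C A : set R) :
  measurable (C : set (measurableTypeR R)) ->
  measurable (A : set (measurableTypeR R)) ->
  bounded_measurable (tilt C A).
Proof.
move=> mC mA; do 2 ?apply: bounded_measurable_lin.
- exact: bounded_measurable_cst.
- by apply: bounded_measurable_indic; exact: measurableI.
- by apply: bounded_measurable_indic; exact: measurableD.
Qed.

Lemma tilt_le1 (R : realType) (C A : set R) (x : R) : piece C ->
  measurable (A : set (measurableTypeR R)) -> `|tilt C A x| <= 1.
Proof.
move=> pC mA.
have := len_le1 _ _ (pieceI _ _ _ pC mA); have := len_ge0 _ (C `&` A).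
have := len_le1 _ _ (pieceD _ _ _ pC mA); have := len_ge0 _ (C `\` A).
rewrite /tilt !indicE in_setI in_setD.
by case: (x \in C); case: (x \in A) => /= *;
  rewrite ler_norml ?mulr0 ?mulr1; lra.
Qed.

Lemma value_tilt_disjoint (R : realType) (C A X : set R) :
  measurable (C : set (measurableTypeR R)) ->
  measurable (A : set (measurableTypeR R)) -> piece X ->
  X `&` C = set0 -> value (tilt C A) X = 0.
Proof.
move=> mC mA pX XC.
by rewrite value_tilt // setIA XC setDE setIA XC !set0I len0 !mulr0 subrr.
Qed.

(** The two weights of [tilt] are crosswise lengths, so gain and loss cancel over the whole of
    [C]. *)
Lemma value_tilt_subset (R : realType) (C A X : set R) :
  measurable (C : set (measurableTypeR R)) ->
  measurable (A : set (measurableTypeR R)) -> piece X ->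
  C `<=` X -> value (tilt C A) X = 0.
Proof.
move=> mC mA pX CX.
have CX' : X `&` C = C by rewrite setIC; exact/setIidPl.
by rewrite value_tilt // setDE !setIA CX' mulrC subrr.
Qed.

Lemma value_tilt_self (R : realType) (C A : set R) :
  measurable (C : set (measurableTypeR R)) -> piece A ->
  value (tilt C A) A = len (C `\` A) * len (C `&` A).
Proof.
move=> mC pA; rewrite value_tilt //; last exact: pA.1.
have -> : A `&` (C `&` A) = C `&` A by rewrite setIC -setIA setIid.
have -> : A `&` (C `\` A) = set0 by rewrite setDE setICA setICr setI0.
by rewrite len0 mulr0 subr0.
Qed.

(** The prefix [[0, x]] either misses the cell or contains it; the cell is half-open so that [x = a]
    falls under the first case. Hence a tilt inside a cell without revealed points leaves every
    revealed mass intact. *)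
Lemma mass_tilt (R : realType) (a b x : R) (A : set R) :
  0 <= a -> b <= 1 -> measurable (A : set (measurableTypeR R)) ->
  0 <= x <= 1 -> x <= a \/ b <= x -> mass (tilt `]a, b] A) x = 0.
Proof.
move=> a0 b1 mA /andP[x0 x1] xab.
have pX : piece `[0, x] by exact: piece_itv.
have mC := measurable_itv `]a, b] : measurable (_ : set (measurableTypeR R)).
rewrite /mass; case: xab => [xa|bx].
  apply: value_tilt_disjoint => //; rewrite -subset0 => z [] /=.
  by rewrite !in_itv /= => /andP[_ zx] /andP[az _]; have := lt_le_trans az zx; lra.
apply: value_tilt_subset => // z /=; rewrite !in_itv /= => /andP[az zb].
by apply/andP; split; lra.
Qed.

(** This is the leverage of a tilt at an interior point [y] of a cell: it is positive, so a suitable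
    multiple gives [y] any prescribed mass close enough to the current one. *)
Lemma mass_tilt_itv (R : realType) (a b y : R) :
  0 <= a -> a <= y -> y <= b -> b <= 1 ->
  mass (tilt `]a, b] `[0, y]) y = (b - y) * (y - a).
Proof.
move=> a0 ay yb b1.
have pX : piece `[0, y] by apply: piece_itv => //; lra.
have mC := measurable_itv `]a, b] : measurable (_ : set (measurableTypeR R)).
rewrite /mass value_tilt_self //.
have pC : piece `]a, b] by exact: piece_itv.
have CD : `]a, b]%classic `\` `[0, y]%classic = `]y, b]%classic.
  apply/seteqP; split => z /=; rewrite !in_itv /=.
    by move=> [/andP[az ->]] /negP; rewrite negb_and andbT -!ltNge; case/orP; lra.
  move=> /andP[yz zb]; split; first by apply/andP; split; lra.
  by move=> /andP[_]; lra.
have lo (s t : R) : s <= t -> len `]s, t]%classic = t - s.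
  rewrite /len lebesgue_measure_itv /= lte_fin le_eqVlt => /predU1P[->|st].
    by rewrite ltxx subrr.
  by rewrite st.
have := len_split _ _ _ pC pX.1.
by rewrite CD !lo ?(le_trans ay) // => H; congr (_ * _); lra.
Qed.

(** * Densities close to the uniform one *)

(** When [d < 1] the density is bounded away from zero, so mass is strictly increasing and a cut
    query has at most one correct reply. The freedom of the cut oracle then disappears. *)
Definition near_uniform {R : realType} (d : R) (f : R -> R) : Prop :=
  [/\ measurable_fun [set: R] f, forall x, `|f x - 1| <= d & mass f 1 = 1].

Lemma near_uniform_le (R : realType) (c d : R) (f : R -> R) :
  c <= d -> near_uniform c f -> near_uniform d f.
Proof. by move=> cd [mf f1 ff]; split => // x; exact: le_trans (f1 x) cd. Qed.

Lemma near_uniform_cst (R : realType) (d : R) : 0 <= d ->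
  near_uniform d (fun=> 1).
Proof.
move=> d0; split => [||]; first exact: measurable_cst.
  by move=> x; rewrite subrr normr0.
rewrite /mass value_cst ?len_itv ?subr0 ?mulr1 //.
exact: piece_itv.
Qed.

Lemma near_uniform_bounded (R : realType) (d : R) (f : R -> R) :
  near_uniform d f -> bounded_measurable f.
Proof.
move=> [mf f1 _]; split => //; exists (1 + d) => x.
by have := f1 x; rewrite !ler_norml; lra.
Qed.

Lemma near_uniform_density (R : realType) (d : R) (f : R -> R) : d <= 1 ->
  near_uniform d f -> density f.
Proof.
move=> d1 nf; have bf := near_uniform_bounded _ _ _ nf.
case: nf => mf f1 ff; split => //.
  by apply: bounded_measurable_integrable => //; exact: piece_cake.
by move=> x _; have := f1 x; rewrite ler_norml; lra.
Qed.

Lemma mass0 (R : realType) (f : R -> R) : mass f 0 = 0.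
Proof. by rewrite /mass /value set_itv1 Rintegral_set1. Qed.

Lemma mass_increase (R : realType) (d : R) (f : R -> R) (x y : R) :
  near_uniform d f -> 0 <= x -> x <= y -> y <= 1 ->
  (1 - d) * (y - x) <= mass f y - mass f x <= (1 + d) * (y - x).
Proof.
move=> nf x0 xy y1; have bf := near_uniform_bounded _ _ _ nf.
case: nf => mf f1 ff; rewrite -value_interval //.
have pX : piece `[x, y] by exact: piece_itv.
have bc c := bounded_measurable_cst R c.
rewrite -(len_itv _ x y) // -!value_cst //.
by apply/andP; split; apply: le_value => // z; have := f1 z; rewrite ler_norml; lra.
Qed.

Lemma mass_inj (R : realType) (d : R) (f : R -> R) (x y : R) : d < 1 ->
  near_uniform d f -> 0 <= x <= 1 -> 0 <= y <= 1 -> mass f x = mass f y -> x = y.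
Proof.
move=> d1 nf; wlog xy : x y / x <= y => [H|] x01 y01 fxy.
  by case: (leP x y) => [|/ltW] ?; [exact: H | apply/esym/H].
have /andP[H _] : (1 - d) * (y - x) <= mass f y - mass f x <= (1 + d) * (y - x).
  by apply: mass_increase => //; lra.
have : (1 - d) * (y - x) <= 0 by lra.
by rewrite pmulr_rle0; lra.
Qed.

Lemma mass_surj (R : realType) (d : R) (f : R -> R) (w : R) :
  near_uniform d f -> 0 <= w <= 1 -> exists2 y, 0 <= y <= 1 & mass f y = w.
Proof.
move=> nf w01; have bf := near_uniform_bounded _ _ _ nf.
have [||c c01 fc] := @IVT R (mass f) 0 1 w ler01.
- apply: parameterized_integral_continuous => //.
  by apply: bounded_measurable_integrable => //; exact: piece_cake.
- by case: nf => _ _ ->; rewrite mass0 min_l ?max_r.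
by exists c => //; rewrite in_itv in c01.
Qed.

Lemma near_uniform_tilt (R : realType) (d t e a b : R) (f : R -> R) (A : set R) :
  near_uniform d f -> `|e| <= t -> 0 <= a -> b <= 1 ->
  measurable (A : set (measurableTypeR R)) ->
  near_uniform (d + t) (fun x => f x + e * tilt `]a, b] A x).
Proof.
move=> nf et a0 b1 mA; have bf := near_uniform_bounded _ _ _ nf.
case: nf => mf f1 ff.
have pC : piece `]a, b] by exact: piece_itv.
have bt := bounded_measurable_tilt _ _ _ pC.1 mA.
split.
- by case: (bounded_measurable_lin _ _ _ e bf bt).
- move=> x; rewrite addrAC (le_trans (ler_normD _ _)) // lerD // normrM.
  by rewrite -[t]mulr1 ler_pM // tilt_le1.
- rewrite {1}/mass value_lin //; last by exact: piece_itv.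
  rewrite -/(mass f 1) ff -/(mass (tilt _ _) 1) mass_tilt ?ler01 ?lexx ?mulr0 ?addr0 //.
  by right.
Qed.

Lemma mass_add_tilt (R : realType) (e a b x : R) (f : R -> R) (A : set R) :
  bounded_measurable f -> 0 <= a -> b <= 1 ->
  measurable (A : set (measurableTypeR R)) -> 0 <= x <= 1 ->
  mass (fun z => f z + e * tilt `]a, b] A z) x =
  mass f x + e * mass (tilt `]a, b] A) x.
Proof.
move=> bf a0 b1 mA /andP[x0 x1].
rewrite /mass value_lin //; last exact: piece_itv.
have pC : piece `]a, b] by exact: piece_itv.
exact: (bounded_measurable_tilt _ _ _ pC.1 mA).
Qed.

(** * Generic extension of the revealed points *)

(** When nonempty, such a [G] is a countable subgroup of the plane that misses the fair point;
    countability is what makes a generic new generator available. *)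
Definition halving_free {R : realType} (G : set (R * R)) : Prop :=
  [/\ countable G, forall g h, G g -> G h -> G (g - h)
    & ~ G (2^-1, 2^-1)].

Definition adjoin {R : realType} (G : set (R * R)) (p : R * R) : set (R * R) :=
  [set g | exists g0 (z : int), G g0 /\ g = g0 + p *~ z].

Lemma sub_adjoin (R : realType) (G : set (R * R)) (p : R * R) : G `<=` adjoin G p.
Proof. by move=> g Gg; exists g, 0; rewrite mulr0z addr0. Qed.

Lemma mem_adjoin (R : realType) (G : set (R * R)) (p : R * R) :
  G 0 -> adjoin G p p.
Proof. by exists 0, 1; rewrite add0r mulr1z. Qed.

Lemma halving_free_adjoin (R : realType) (G : set (R * R)) (p : R * R) :
  halving_free G ->
  (forall g (z : int), G g -> z != 0 -> g + p *~ z <> (2^-1, 2^-1)) ->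
  halving_free (adjoin G p).
Proof.
move=> [cG GB G2] H; split.
- have cGz : countable (G `*` [set: int]) by exact: countableX.
  apply: sub_countable cGz.
  apply: card_le_trans (card_image_le (fun t : R * R * int => t.1 + p *~ t.2) _).
  by apply: subset_card_le => _ [g [z [Gg ->]]]; exists (g, z).
- move=> _ _ [g [m [Gg ->]]] [h [n [Gh ->]]].
  exists (g - h), (m - n); split; first exact: GB.
  by rewrite mulrzBr opprD addrACA.
- move=> [g [z [Gg e]]]; have [z0|z0] := eqVneq z 0.
    by apply: G2; rewrite e z0 mulr0z addr0.
  by apply: (H g z) => //; rewrite -e.
Qed.

Lemma countable_avoid (R : realType) (B : set R) (a b : R) :
  countable B -> a < b -> exists2 x, a < x < b & ~ B x.
Proof.
move=> cB ab; apply: contrapT => H.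
have sB : `]a, b[%classic `<=` B.
  move=> x; rewrite /= in_itv /= => xab; apply: contrapT => Bx.
  by apply: H; exists x.
have := countable_lebesgue_measure0 (sub_countable (subset_card_le sB) cB).
by rewrite lebesgue_measure_itv /= lte_fin ab => -[]; lra.
Qed.

(** A pair [(g, z)] with [z != 0] determines [w] as [(c - k g) / z], so the solutions form the image
    of a countable set. In use, [k] is a coordinate projection and the set holds all the bad choices
    of a coordinate. *)
Lemma countable_solutions (R : realType) (G : set (R * R)) (k : R * R -> R) (c : R) :
  countable G ->
  countable [set w | exists g (z : int), [/\ G g, z != 0 & k g + w *~ z = c]].
Proof.
move=> cG; have cGz : countable (G `*` [set: int]) by exact: countableX.
apply: sub_countable cGz.
apply: card_le_trans
  (card_image_le (fun t : R * R * int => (c - k t.1) / t.2%:~R) _).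
apply: subset_card_le => w [g [z [Gg z0 <-]]]; exists (g, z) => //=.
by rewrite addrC addKr -mulrzr mulfK // intr_eq0.
Qed.

(** Avoiding [2^-1] in one coordinate suffices. This version serves a prescribed point whose market
    value is free; the next one serves a prescribed market value whose point is free. *)
Lemma halving_free_adjoin_snd (R : realType) (G : set (R * R)) (x a b : R) :
  halving_free G -> a < b ->
  exists2 w, a < w < b & halving_free (adjoin G (x, w)).
Proof.
move=> hG ab; have [cG _ _] := hG.
have [w wab Hw] := countable_avoid _ _ _ _ (countable_solutions _ _ snd 2^-1 cG) ab.
exists w => //; apply: halving_free_adjoin => // g z Gg z0 e.
by apply: Hw; exists g, z; split => //; rewrite -[RHS](congr1 snd e) /= raddfMz.
Qed.

Lemma halving_free_adjoin_fst (R : realType) (G : set (R * R)) (y a b : R) :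
  halving_free G -> a < b ->
  exists2 x, a < x < b & halving_free (adjoin G (x, y)).
Proof.
move=> hG ab; have [cG _ _] := hG.
have [w wab Hw] := countable_avoid _ _ _ _ (countable_solutions _ _ fst 2^-1 cG) ab.
exists w => //; apply: halving_free_adjoin => // g z Gg z0 e.
by apply: Hw; exists g, z; split => //; rewrite -[RHS](congr1 fst e) /= raddfMz.
Qed.

(** * The adversary *)

(* The density may still move by [e] before leaving [near_uniform 2^-1]; [G]
   contains the group generated by the revealed points, those above [D]. *)
Record adversary {R : realType} (e : R) (f : R -> R) (D : seq R)
    (G : set (R * R)) : Prop := Adversary {
  adversary_density : near_uniform (2^-1 - e) f;
  adversary_group : halving_free G;
  adversary_cake : {in D, forall x, 0 <= x <= 1};
  adversary_zero : 0 \in D;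
  adversary_one : 1 \in D;
  adversary_points : {in D, forall x, G (x, mass f x)} }.

(** The density pays for its change out of the budget: the bounds [e - e'] telescope along a run,
    which makes the densities converge uniformly, while masses already revealed are frozen. *)
Record refines {R : realType} (e : R) (f : R -> R) (D : seq R)
    (e' : R) (f' : R -> R) (D' : seq R) : Prop := Refines {
  refines_dist : forall x, `|f' x - f x| <= e - e';
  refines_mass : {in D, mass f' =1 mass f};
  refines_sub : {subset D <= D'} }.

Lemma adversary_le (R : realType) (e e' : R) f D (G : set (R * R)) :
  e' <= e -> adversary e f D G -> adversary e' f D G.
Proof.
by move=> ee [nf *]; split => //; apply: near_uniform_le nf; rewrite lerD2l lerN2.
Qed.

Lemma refines_le (R : realType) (e e1 e2 : R) f f' D D' :
  e2 <= e1 -> refines e f D e1 f' D' -> refines e f D e2 f' D'.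
Proof.
by move=> ee [ff *]; split => // x; rewrite (le_trans (ff x)) // lerD2l lerN2.
Qed.

Lemma refines_refl (R : realType) (e e' : R) f D :
  e' <= e -> refines e f D e' f D.
Proof. by move=> ee; split => // x; rewrite subrr normr0 subr_ge0. Qed.

Lemma refines_cons (R : realType) (e e' y : R) f D :
  e' <= e -> refines e f D e' f (y :: D).
Proof.
move=> ee; split => // [x|x xD]; first by rewrite subrr normr0 subr_ge0.
by rewrite inE xD orbT.
Qed.

Lemma refines_trans (R : realType) (e0 e1 e2 : R) f0 f1 f2 D0 D1 D2 :
  refines e0 f0 D0 e1 f1 D1 -> refines e1 f1 D1 e2 f2 D2 ->
  refines e0 f0 D0 e2 f2 D2.
Proof.
move=> [d01 m01 s01] [d12 m12 s12]; split => [x|x xD|x /s01 /s12 //].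
  rewrite (le_trans (ler_distD (f1 x) _ _)) //.
  by have := d01 x; have := d12 x; lra.
by rewrite m12 ?m01 // s01.
Qed.

Lemma adversary_cons (R : realType) (e y : R) f D (G : set (R * R)) :
  adversary e f D G -> y \in D -> adversary e f (y :: D) G.
Proof.
move=> [nf hG D01 D0 D1 DG] yD.
split => //; rewrite ?inE ?D0 ?D1 ?orbT // => x; rewrite inE => /predU1P[->|xD].
- exact: D01.
- exact: D01.
- exact: DG.
- exact: DG.
Qed.

(** A tilt by [[0, y]] inside the cell of [y] corrects the mass at [y] to [w]; the assumed closeness
    of [w] is exactly what half of the budget can achieve. *)
Lemma adversary_insert (R : realType) (e a b y w : R) f D (G : set (R * R)) :
  adversary e f D G -> 0 <= a -> a < y -> y < b -> b <= 1 ->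
  {in D, forall x, x <= a \/ b <= x} ->
  `|w - mass f y| <= e / 2 * ((b - y) * (y - a)) ->
  halving_free (adjoin G (y, w)) ->
  exists f', [/\ adversary (e / 2) f' (y :: D) (adjoin G (y, w)),
    refines e f D (e / 2) f' (y :: D) & mass f' y = w].
Proof.
move=> [nf hG D01 D0 D1 DG] a0 ay yb b1 Dab wy hGw.
have bf := near_uniform_bounded _ _ _ nf.
have c0 : 0 < (b - y) * (y - a) by rewrite mulr_gt0 ?subr_gt0.
have G0 : G 0 by have := DG _ D0; rewrite mass0.
(* By [mass_tilt_itv], this coefficient shifts the mass at [y] by [w - mass f y]. *)
pose d := (w - mass f y) / ((b - y) * (y - a)).
have de : `|d| <= e / 2 by rewrite normrM normfV (gtr0_norm c0) ler_pdivrMr.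
have dK : d * ((b - y) * (y - a)) = w - mass f y.
  by rewrite /d divfK // gt_eqF.
have mY := (piece_itv R true false 0 y (lexx 0) (ltW (lt_le_trans yb b1))).1.
have m' x : 0 <= x <= 1 ->
    mass (fun z => f z + d * tilt `]a, b] `[0, y] z) x =
    mass f x + d * mass (tilt `]a, b] `[0, y]) x.
  exact: mass_add_tilt.
have mD : {in D, mass (fun z => f z + d * tilt `]a, b] `[0, y] z) =1 mass f}.
  by move=> x xD; rewrite m' ?mass_tilt ?mulr0 ?addr0; auto.
have my : mass (fun z => f z + d * tilt `]a, b] `[0, y] z) y = w.
  rewrite m'; last by lra.
  by rewrite mass_tilt_itv ?dK ?(ltW ay) ?(ltW yb) // addrC subrK.
exists (fun z => f z + d * tilt `]a, b] `[0, y] z); split => //; last first.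
  split => // [x|x xD]; last by rewrite inE xD orbT.
  have pC := piece_itv R false false a b a0 b1.
  rewrite addrC addKr normrM -[leRHS]mulr1 ler_pM ?tilt_le1 //.
  by rewrite (le_trans de) //; lra.
split => //; rewrite ?inE ?D0 ?D1 ?orbT //.
- by have := near_uniform_tilt _ _ _ _ _ _ _ _ nf de a0 b1 mY;
    apply: near_uniform_le; lra.
- by move=> x; rewrite inE => /predU1P[->|/D01 //]; lra.
- move=> x; rewrite inE => /predU1P[->|xD].
    by rewrite my; exact: mem_adjoin.
  by rewrite mD //; apply: sub_adjoin; exact: DG.
Qed.

Lemma seq_isolated (R : realType) (D : seq R) (y : R) : y \notin D ->
  exists2 r, 0 < r & {in D, forall x, x <= y - r \/ y + r <= x}.
Proof.
elim: D => [|d D IH]; first by exists 1.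
rewrite inE negb_or => /andP[yd /IH[r r0 Dr]].
have yd0 : 0 < `|y - d| by rewrite normr_gt0 subr_eq0.
exists (Num.min r `|y - d|); first by rewrite lt_min r0.
move=> x; rewrite inE => /predU1P[->|/Dr H].
  have : Num.min r `|y - d| <= `|y - d| by rewrite ge_min lexx orbT.
  case: (ltgtP y d) yd => // yd _ H; [right|left]; move: H.
    by rewrite ltr0_norm ?subr_lt0 //; lra.
  by rewrite gtr0_norm ?subr_gt0 //; lra.
have : Num.min r `|y - d| <= r by rewrite ge_min lexx.
by case: H => H H'; [left|right]; lra.
Qed.

Lemma adversary_isolated (R : realType) (e y : R) f D (G : set (R * R)) :
  adversary e f D G -> 0 <= y <= 1 -> y \notin D ->
  exists r, [/\ 0 < r, 0 <= y - r, y + r <= 1 &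
    {in D, forall x, x <= y - r \/ y + r <= x}].
Proof.
move=> [_ _ _ D0 D1 _] y01 /seq_isolated[r r0 Dr].
by exists r; split => //; [case: (Dr _ D0) | case: (Dr _ D1)]; lra.
Qed.

Lemma adversary_eval (R : realType) (e y : R) f D (G : set (R * R)) :
  adversary e f D G -> 0 < e -> 0 <= y <= 1 ->
  exists f' G', adversary (e / 2) f' (y :: D) G' /\
    refines e f D (e / 2) f' (y :: D).
Proof.
move=> sf e0 y01; have e2 : e / 2 <= e by lra.
case: (boolP (y \in D)) => yD.
  exists f, G; split; last exact: refines_cons.
  by apply: adversary_le e2 _; exact: adversary_cons.
have [r [r0 yr0 yr1 Dr]] := adversary_isolated _ _ _ _ _ _ sf y01 yD.
(* In a cell of radius [r] around [y], coefficients up to [e / 2] shift the mass at [y] by up to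
   [e / 2 * (r * r)]; [w] is picked generically in that range. *)
have s0 : 0 < e / 2 * (r * r) by rewrite !mulr_gt0 //; lra.
have ls : mass f y < mass f y + e / 2 * (r * r) by lra.
have [w wab hw] :=
  halving_free_adjoin_snd _ _ y _ _ (adversary_group _ _ _ _ sf) ls.
have [|||f' [sf' rf' _]] :=
  adversary_insert _ _ (y - r) (y + r) y w _ _ _ sf yr0 _ _ yr1 Dr _ hw; try lra.
  have -> : (y + r - y) * (y - (y - r)) = r * r by ring.
  by rewrite ler_norml; lra.
by exists f', (adjoin G (y, w)).
Qed.

(** The mass [w] is prescribed, so the point must be generic: [y] is taken slightly to the right of
    the current solution [z], and the density is tilted to make [y] the solution. *)
Lemma adversary_cut (R : realType) (e w : R) f D (G : set (R * R)) :
  adversary e f D G -> 0 < e -> e <= 2^-1 -> 0 <= w <= 1 ->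
  exists y f' G', [/\ 0 <= y <= 1, mass f' y = w,
    adversary (e / 2) f' (y :: D) G' & refines e f D (e / 2) f' (y :: D)].
Proof.
move=> sf e0 eh w01; have e2 : e / 2 <= e by lra.
have nf := adversary_density _ _ _ _ sf.
have [z z01 fz] := mass_surj _ _ _ _ nf w01.
case: (boolP (z \in D)) => zD.
  exists z, f, G; split => //; last exact: refines_cons.
  by apply: adversary_le e2 _; exact: adversary_cons.
have [r [r0 zr0 zr1 Dr]] := adversary_isolated _ _ _ _ _ _ sf z01 zD.
(* The bound [r / 2] keeps [y] off the end of the cell, so the available shift is at least
   [e / 2 * (r / 2 * r)]. The bound [e / 8 * (r * r)] keeps the needed shift, at most [2 * (y - z)],
   below that amount. *)
pose s := Num.min (r / 2) (e / 8 * (r * r)).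
have s0 : 0 < s by rewrite lt_min !divr_gt0 // !mulr_gt0 // invr_gt0.
have sr : s <= r / 2 by rewrite ge_min lexx.
have se : s <= e / 8 * (r * r) by rewrite ge_min lexx orbT.
have ls : z < z + s by lra.
have [y yab hy] :=
  halving_free_adjoin_fst _ _ w _ _ (adversary_group _ _ _ _ sf) ls.
have [|||f' [sf' rf' fy]] :=
  adversary_insert _ _ (z - r) (z + r) y w _ _ _ sf zr0 _ _ zr1 Dr _ hy; try lra.
  have /andP[H1 H2] : (1 - (2^-1 - e)) * (y - z) <=
      mass f y - mass f z <= (1 + (2^-1 - e)) * (y - z).
    by apply: mass_increase => //; lra.
  have H3 : r / 2 * r <= (z + r - y) * (y - (z - r)) by apply: ler_pM; lra.
  have H4 : e / 2 * (r / 2 * r) <= e / 2 * ((z + r - y) * (y - (z - r))).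
    by rewrite ler_wpM2l //; lra.
  have H5 : (1 + (2^-1 - e)) * (y - z) <= 2 * (y - z) by apply: ler_wpM2r; lra.
  have H6 : 0 <= (1 - (2^-1 - e)) * (y - z) by apply: mulr_ge0; lra.
  have H7 : e / 2 * (r / 2 * r) = 2 * (e / 8 * (r * r)) by field.
  by rewrite ler_norml; apply/andP; split; lra.
exists y, f', (adjoin G (y, w)); split => //; lra.
Qed.

(** * Replies to queries when all utilities are uniform and only the market varies *)

Definition market_reply {R : realType} {n : nat}
    (cut : (R -> R) -> R -> R -> answer R) (f : R -> R) (q : query R n) :
    answer R :=
  let density_of m := if m is Some _ then fun=> 1 else f in
  match q with
  | Eval m x y _ _ _ => Some (value (density_of m) `[x, y])
  | Cut m x beta _ _ _ => cut (density_of m) x beta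
  end.

Lemma cut_some (R : realType) cut (d : R) (f : R -> R) (x y beta : R) :
  cut_oracle cut -> near_uniform d f -> d < 1 -> 0 <= x <= 1 -> 0 <= y <= 1 ->
  0 <= beta -> mass f y = mass f x + beta -> cut f x beta = Some y.
Proof.
move=> hcut nf d1 /andP[x0 x1] y01 b0 fy.
have bf := near_uniform_bounded _ _ _ nf.
have df : density f by apply: near_uniform_density nf; exact: ltW.
have := hcut f x beta df x0 x1 b0; case: (cut f x beta) => [z [xz z1]|H].
  rewrite value_interval // => H; congr Some.
  by apply: mass_inj d1 nf _ y01 _; lra.
case: (leP x y) => [xy|yx].
  by case: (H y xy); rewrite ?value_interval //; lra.
have /andP[H' _] : (1 - d) * (x - y) <= mass f x - mass f y <= (1 + d) * (x - y).
  by apply: mass_increase => //; lra.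
have : 0 < (1 - d) * (x - y) by apply: mulr_gt0; lra.
by move=> ?; exfalso; lra.
Qed.

Lemma cut_none (R : realType) cut (d : R) (f : R -> R) (x beta : R) :
  cut_oracle cut -> near_uniform d f -> d < 1 -> 0 <= x <= 1 ->
  1 < mass f x + beta -> cut f x beta = None.
Proof.
move=> hcut nf d1 /andP[x0 x1] xb.
have bf := near_uniform_bounded _ _ _ nf.
have df : density f by apply: near_uniform_density nf; exact: ltW.
have incr y z : 0 <= y -> y <= z -> z <= 1 -> mass f y <= mass f z.
  move=> y0 yz z1.
  have /andP[H _] : (1 - d) * (z - y) <= mass f z - mass f y <= (1 + d) * (z - y).
    exact: mass_increase.
  have : 0 <= (1 - d) * (z - y) by apply: mulr_ge0; lra.
  lra.
have f1 : mass f 1 = 1 by case: nf.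
have fx := incr _ _ x0 x1 (lexx 1).
have b0 : 0 <= beta by lra.
have := hcut f x beta df x0 x1 b0; case: (cut f x beta) => // z [xz z1].
rewrite value_interval // => H.
by have := incr _ _ (le_trans x0 xz) z1 (lexx 1); move=> ?; exfalso; lra.
Qed.

(** A market query reveals at most two points, its left end and its right end, and each costs half
    of the remaining budget; hence [e / 4]. Masses at the revealed points then determine the reply,
    for every density near enough to uniform. *)
Lemma adversary_reply (R : realType) (n : nat) cut (e : R) f D (G : set (R * R))
    (q : query R n) :
  cut_oracle cut -> adversary e f D G -> 0 < e -> e <= 2^-1 ->
  exists f' D' G', [/\ adversary (e / 4) f' D' G', refines e f D (e / 4) f' D' &
    forall d g, d < 1 -> near_uniform d g -> {in D', mass g =1 mass f'} ->
      market_reply cut g q = market_reply cut f' q].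
Proof.
move=> hcut sf e0 eh.
have e4 : e / 4 <= e by lra.
(* A query to an agent has a reply independent of the market, so the state need not change. *)
have stay : (forall g, market_reply cut g q = market_reply cut f q) ->
    exists f' D' G', [/\ adversary (e / 4) f' D' G',
      refines e f D (e / 4) f' D' &
      forall d g, d < 1 -> near_uniform d g -> {in D', mass g =1 mass f'} ->
        market_reply cut g q = market_reply cut f' q].
  move=> H; exists f, D, G; split => //.
  - exact: adversary_le e4 sf.
  - exact: refines_refl.
have e20 : 0 < e / 2 by lra.
have e2h : e / 2 <= 2^-1 by lra.
have e22 : e / 2 / 2 = e / 4 by field.
case: q stay => [[i|] x y x0 xy y1|[i|] x beta x0 x1 b0] stay;
  try by apply: stay.
- have [||f1 [G1 [sf1 rf1]]] := adversary_eval _ _ x _ _ _ sf; try lra.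
  have [||f2 [G2 [sf2 rf2]]] := adversary_eval _ _ y _ _ _ sf1; try lra.
  exists f2, (y :: x :: D), G2; rewrite -e22; split => //.
    exact: refines_trans rf1 rf2.
  move=> d g d1 ng gD /=.
  rewrite !value_interval //; try exact: near_uniform_bounded ng;
    try exact: near_uniform_bounded (adversary_density _ _ _ _ sf2).
  by rewrite !gD // !inE eqxx ?orbT.
- have [||f1 [G1 [sf1 rf1]]] := adversary_eval _ _ x _ _ _ sf; try lra.
  have x01 : 0 <= x <= 1 by rewrite x0.
  (* Once the mass at [x] is fixed, it decides whether the cut exists: if so its end point is
     revealed too, otherwise the mass at [x] alone forces the reply [None]. *)
  case: (leP (mass f1 x + beta) 1) => fx.
    have [|||y [f2 [G2 [y01 fy sf2 rf2]]]] :=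
      adversary_cut _ _ (mass f1 x + beta) _ _ _ sf1; try lra.
      have /andP[H _] : (1 - (2^-1 - e / 2)) * (x - 0) <= mass f1 x - mass f1 0 <=
          (1 + (2^-1 - e / 2)) * (x - 0).
        by apply: mass_increase => //; exact: adversary_density sf1.
      have : 0 <= (1 - (2^-1 - e / 2)) * (x - 0) by apply: mulr_ge0; lra.
      by move: H; rewrite mass0; lra.
    have f2x : mass f2 x = mass f1 x.
      by apply: (refines_mass _ _ _ _ _ _ rf2); rewrite inE eqxx.
    exists f2, (y :: x :: D), G2; rewrite -e22; split => //.
      exact: refines_trans rf1 rf2.
    move=> d g d1 ng gD /=.
    rewrite (cut_some _ _ _ _ _ y _ hcut ng) ?gD ?fy ?f2x ?inE ?eqxx ?orbT //.
    apply/esym; apply: (cut_some _ _ _ _ _ y _ hcut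
      (adversary_density _ _ _ _ sf2)) => //; lra.
  exists f1, (x :: D), G1; split.
  - by apply: adversary_le sf1; lra.
  - by apply: refines_le rf1; lra.
  move=> d g d1 ng gD /=.
  rewrite (cut_none _ _ _ _ _ _ hcut ng) ?gD ?inE ?eqxx //.
  apply/esym; apply: (cut_none _ _ _ _ _ _ hcut (adversary_density _ _ _ _ sf1)) => //; lra.
Qed.

(** * Uniform limits of densities *)

Lemma uniform_limit (R : realType) (e : nat -> R) (f : nat -> R -> R) :
  (forall k, 0 <= e k) ->
  (forall k x, `|f k.+1 x - f k x| <= e k - e k.+1) ->
  exists g, forall k x, `|g x - f k x| <= e k.
Proof.
move=> e0 fe; pose u x k := f k x - e k.
(* The intervals from [f k x - e k] to [f k x + e k] are nested in [k], so the supremum of their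
   lower ends lies in all of them. *)
have lo x : {homo u x : m n / (m <= n)%N >-> m <= n}.
  apply: homo_leq => // [? ? ?|k]; first exact: le_trans.
  by rewrite /u; have := fe k x; rewrite ler_norml; lra.
have hi x : {homo (fun k => f k x + e k) : m n / (m <= n)%N >-> n <= m}.
  apply: homo_leq => // [? ? ? ? ?|k]; first by apply: le_trans; eassumption.
  by have := fe k x; rewrite ler_norml; lra.
have uv x j k : u x j <= f k x + e k.
  have := lo x _ _ (leq_maxl j k); have := hi x _ _ (leq_maxr j k).
  by rewrite /u; have := e0 (maxn j k); lra.
exists (fun x => sup (range (u x))) => k x.
have su : has_sup (range (u x)).
  by split; [exists (u x 0%N), 0%N | exists (f 0%N x + e 0%N) => _ [j _ <-]; exact: uv].
have H1 : u x k <= sup (range (u x)) by apply: ub_le_sup; [exact: su.2 | exists k].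
have H2 : sup (range (u x)) <= f k x + e k.
  by apply: ge_sup; [exact: su.1 | move=> _ [j _ <-]; exact: uv].
by move: H1 H2; rewrite /u ler_norml; lra.
Qed.

Lemma le_add_vanishing (R : realType) (e : nat -> R) (N : nat) (a c : R) :
  e @ \oo --> (0 : R) -> (forall k, (N <= k)%N -> a <= c + e k) -> a <= c.
Proof.
move=> e0 H; rewrite leNgt; apply/negP => ca.
have : \forall k \near \oo, `|0 - e k| < a - c.
  by move/cvgrPdist_lt : e0; apply; rewrite subr_gt0.
move=> [M _ HM]; have := HM (maxn M N) (leq_maxl _ _).
have := H _ (leq_maxr M N); rewrite /= ltr_norml; lra.
Qed.

(** An error [e k] on the density gives an error at most [e k] on each mass, the cake having length
    1; a mass that is eventually constant therefore passes to the limit exactly. *)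
Lemma near_uniform_limit (R : realType) (d : R) (e : nat -> R) (f : nat -> R -> R)
    (g : R -> R) :
  e @ \oo --> (0 : R) -> (forall k x, `|g x - f k x| <= e k) ->
  (forall k, near_uniform d (f k)) ->
  near_uniform d g /\ forall N x c, 0 <= x <= 1 ->
    (forall k, (N <= k)%N -> mass (f k) x = c) -> mass g x = c.
Proof.
move=> e0 fg nf.
have mg : measurable_fun [set: R] g.
  apply: (@measurable_fun_cvg _ _ _ _ f) => [k|x _]; first by case: (nf k).
  apply/cvgrPdist_lt => t t0; move/cvgrPdist_lt : e0 => /(_ _ t0).
  apply: filterS => k; rewrite sub0r normrN; apply: le_lt_trans.
  by rewrite (le_trans (fg k x)) // ler_norm.
have gd x : `|g x - 1| <= d.
  apply: (le_add_vanishing _ _ 0 _ _ e0) => k _.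
  rewrite (le_trans (ler_distD (f k x) _ _)) // addrC lerD //.
  by case: (nf k).
have bg : bounded_measurable g.
  by split => //; exists (1 + d) => x; have := gd x; rewrite !ler_norml; lra.
have mgl N x c : 0 <= x <= 1 ->
    (forall k, (N <= k)%N -> mass (f k) x = c) -> mass g x = c.
  move=> /andP[x0 x1] fc.
  have H k : (N <= k)%N -> `|mass g x - c| <= e k.
    move=> Nk; rewrite -(fc _ Nk); apply: value_dist => //.
    - exact: near_uniform_bounded (nf k).
    - exact: piece_itv.
    - exact: le_trans (normr_ge0 _) (fg k 0).
  apply/eqP; rewrite -subr_eq0 -normr_le0.
  by apply: (le_add_vanishing _ _ N _ _ e0) => k Nk; rewrite add0r H.
split => //; split => //; apply: (mgl 0 1 1); first by rewrite ler01 lexx.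
by move=> k _; case: (nf k).
Qed.

(** * Shares that are unions of cells *)

Lemma predecessor_in_seq (R : realType) (D : seq R) (a x : R) :
  a \in D -> a < x ->
  exists b, [/\ b \in D, b < x & {in D, forall y, y <= b \/ x <= y}].
Proof.
elim: D a => // d D IH a aD ax.
have [/hasP[c cD cx]|/hasPn H] := boolP (has (fun c => c < x) D).
  have [b [bD bx Hb]] := IH c cD cx.
  have [dx|xd] := ltP d x; last first.
    exists b; split => //; first by rewrite inE bD orbT.
    by move=> y; rewrite inE => /predU1P[->|/Hb //]; right.
  have [db|bd] := leP d b.
    exists b; split => //; first by rewrite inE bD orbT.
    by move=> y; rewrite inE => /predU1P[->|/Hb //]; left.
  exists d; split => //; first by rewrite inE eqxx.
  move=> y; rewrite inE => /predU1P[->|/Hb[yb|]]; [by left| |by right].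
  by left; lra.
have ad : a = d.
  by move: aD; rewrite inE => /predU1P[//|/H]; rewrite ax.
exists d; split; rewrite ?inE ?eqxx // -?ad //.
move=> y; rewrite inE => /predU1P[->|/H]; first by left.
by rewrite -leNgt; right.
Qed.

Lemma value_prefix_split (R : realType) (X : set R) (f : R -> R) (a x : R) :
  bounded_measurable f -> piece X -> 0 <= a -> a <= x ->
  value f (X `&` `[0, x]) = value f (X `&` `[0, a]) + value f (X `&` `]a, x]).
Proof.
move=> bf pX a0 ax.
have mi (b c : bool) (s t : R) :
    measurable ([set` Interval (BSide b s) (BSide c t)] : set (measurableTypeR R)).
  exact: measurable_itv.
rewrite (value_split _ _ (X `&` `[0, x]) `[0, a]%classic bf) //; last exact: pieceI.
congr (_ + _); congr (value f _); apply/seteqP; split => z /=; rewrite !in_itv /=.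
- by case => -[].
- by case => Xz /andP[z0 za]; rewrite z0 za (le_trans za ax).
- move=> [[Xz /andP[z0 zx]]] /negP; rewrite z0 /= -ltNge => az.
  by rewrite az zx.
- move=> [Xz /andP[az zx]]; rewrite zx (ltW (le_lt_trans a0 az)); split => //.
  by apply/negP; rewrite -ltNge.
Qed.

Lemma ltn_count (T : eqType) (p q : pred T) (s : seq T) (a : T) :
  subpred p q -> a \in s -> q a -> ~~ p a -> (count p s < count q s)%N.
Proof.
move=> pq + qa pa; elim: s => // b s IH; rewrite inE => /predU1P[<-|/IH H] /=.
  by rewrite qa (negbTE pa) add0n add1n ltnS sub_count.
by rewrite -addnS leq_add //; case: (boolP (p b)) => // /pq ->.
Qed.

(* If every such [g] gave [A] value 1/2, then [A] would contain almost all or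
   almost nothing of each cell of [D]: otherwise tilting [f] inside the cell
   would change the value of [A]. So the length and the value of [A] would be
   sums of cell lengths and cell values, and the pair would lie in [G]. *)
Lemma no_robust_halving (R : realType) (d t : R) (f : R -> R) (D : seq R)
    (G : set (R * R)) (A : set R) :
  near_uniform d f -> 0 < t -> halving_free G ->
  {in D, forall x, 0 <= x <= 1} -> 0 \in D -> 1 \in D ->
  {in D, forall x, G (x, mass f x)} -> piece A -> len A = 2^-1 ->
  ~ (forall g, near_uniform (d + t) g -> {in D, mass g =1 mass f} ->
       value g A = 2^-1).
Proof.
move=> nf t0 hG D01 D0 D1 DG pA lA robust.
have bf := near_uniform_bounded _ _ _ nf.
have b1 := bounded_measurable_cst R 1.
have mi (b c : bool) (s u : R) :
    measurable ([set` Interval (BSide b s) (BSide c u)] : set (measurableTypeR R)).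
  exact: measurable_itv.
have vA : value f A = 2^-1.
  by apply: robust => //; apply: near_uniform_le nf; lra.
have v1 X : piece X -> value (fun=> 1) X = len X.
  by move=> pX; rewrite value_cst // mul1r.
have [_ GB G2] := hG.
have G0 : G (0, 0) by have := DG _ D0; rewrite mass0.
have GD g h : G g -> G h -> G (g + h).
  by move=> Gg Gh; rewrite -[h]opprK; apply: (GB) => //; rewrite -[- h]add0r; exact: GB.
pose cum x := (len (A `&` `[0, x]), value f (A `&` `[0, x])).
have pAi (b c : bool) (s u : R) :
    piece (A `&` [set` Interval (BSide b s) (BSide c u)]) by exact: pieceI.
(* At [x = 1] the pair [cum x] is [(2^-1, 2^-1)]. The claim is proved cell by cell, by induction on
   the number of revealed points to the left of [x]. *)
suff H x : x \in D -> G (cum x).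
  apply: G2; have := H _ D1; rewrite /cum.
  by have /setIidPl -> := pA.2; rewrite lA vA.
have [n] := ubnP (count (fun y => y < x) D); elim: n x => // n IH x xn xD.
have [x0 x1] : 0 <= x /\ x <= 1 by case/andP: (D01 _ xD).
move: (x0); rewrite le_eqVlt => /predU1P[<-|xp].
  have l0 : len (A `&` `[0, 0]) = 0.
    apply/eqP; rewrite eq_le len_ge0 andbT.
    have := len_split _ `[0, 0] A (piece_itv _ _ _ _ _ (lexx 0) ler01) pA.1.
    rewrite len_itv // subrr setIC => H.
    by have := len_ge0 _ (`[0, 0] `\` A); lra.
  by rewrite /cum l0 value_null.
have [a [aD ax Da]] := predecessor_in_seq _ _ _ _ D0 xp.
have /andP[a0 a1] := D01 _ aD.
have GA : G (cum a).
  apply: IH => //; rewrite -ltnS (leq_trans _ xn) // ltnS.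
  by apply: (ltn_count _ _ _ _ a) => //;
    [move=> y ya; exact: lt_trans ya ax | rewrite ltxx].
have pC : piece `]a, x] by exact: piece_itv.
have cum_x : cum x = cum a + (len (A `&` `]a, x]), value f (A `&` `]a, x])).
  have ax' := ltW ax.
  by rewrite /cum -!v1 // (value_prefix_split _ _ _ a x b1) //
    (value_prefix_split _ _ _ a x bf).
rewrite cum_x; apply: GD => //.
(* Tilting by [A] inside the last cell keeps all revealed masses, so robustness applies; but it
   changes the value of [A] by [t] times the product of the lengths of the cell inside and outside
   [A]. *)
have : value (fun z => f z + t * tilt `]a, x] A z) A = 2^-1.
  have tt : `|t| <= t by rewrite gtr0_norm.
  apply: robust; first exact: near_uniform_tilt nf tt a0 x1 pA.1.
  move=> y yD; have mA := pA.1; have y01 := D01 _ yD; have Dy := Da _ yD.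
  by rewrite mass_add_tilt ?mass_tilt ?mulr0 ?addr0.
have bt := bounded_measurable_tilt _ _ _ pC.1 pA.1.
rewrite value_lin // vA value_tilt_self //.
(* So one of the two lengths is zero. A cell almost inside [A] contributes
   [(x, mass f x) - (a, mass f a)], a cell almost outside contributes zero; both are in [G]. *)
move=> /eqP; rewrite -subr_eq0 addrC addKr !mulf_eq0 gt_eqF //= => /orP[/eqP H|/eqP H].
  have := len_split _ _ _ pC pA.1; rewrite H addr0 setIC => <-.
  have := value_split _ _ _ _ bf pC pA.1.
  rewrite (value_null _ _ (`]a, x] `\` A)) ?addr0 //; last first.
    by apply: pieceD => //; exact: pA.1.
  rewrite setIC => <-.
  have -> : len `]a, x] = x - a.
    by rewrite /len lebesgue_measure_itv /= lte_fin ax.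
  have -> : value f `]a, x] = mass f x - mass f a.
    rewrite /mass /value Rintegral_itvB ?bnd_simp ?(ltW ax) //.
    by apply: bounded_measurable_integrable => //; exact: piece_itv.
  exact: (GB (x, mass f x) (a, mass f a)) (DG _ xD) (DG _ aD).
by rewrite setIC in H; rewrite H value_null.
Qed.

(** * The limit instance *)

(** The ratio [4^-1] matches the budget left after one query, and the initial [2^-1] leaves the
    starting density exactly uniform. *)
Definition tolerance {R : realType} (k : nat) : R := 2^-1 * 4^-1 ^+ k.

Lemma tolerance_gt0 (R : realType) (k : nat) : 0 < tolerance k :> R.
Proof. by rewrite mulr_gt0 ?exprn_gt0 ?invr_gt0. Qed.

Lemma tolerance_le (R : realType) (k : nat) : tolerance k <= 2^-1 :> R.
Proof.
rewrite /tolerance -[leRHS]mulr1 ler_wpM2l ?invr_ge0 // exprn_ile1 ?invr_ge0 //.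
by rewrite invf_le1 //; lra.
Qed.

Lemma toleranceS (R : realType) (k : nat) :
  tolerance k.+1 = tolerance k / 4 :> R.
Proof. by rewrite /tolerance exprSr mulrA. Qed.

Lemma cvg_tolerance (R : realType) : (tolerance : nat -> R) @ \oo --> (0 : R).
Proof.
rewrite -[X in _ --> X](mulr0 2^-1); apply: cvgM; first exact: cvg_cst.
by apply: cvg_expr; rewrite gtr0_norm ?invr_gt0 // invf_lt1 //; lra.
Qed.

(** The points known at the outset, [(0, 0)] and [(1, 1)], generate the integer points of the
    diagonal, and [2^-1] is not an integer. *)
Lemma adversary_start (R : realType) :
  adversary (tolerance 0) (fun=> 1) [:: 0; 1]
    [set g : R * R | exists z : int, g = (z%:~R, z%:~R)].
Proof.
have t0 : tolerance 0 = 2^-1 :> R by rewrite /tolerance expr0 mulr1.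
split; rewrite ?inE ?eqxx ?orbT //.
- by rewrite t0 subrr; exact: near_uniform_cst.
- split.
  + apply: sub_countable (countableP [set: int]).
    apply: card_le_trans
      (card_image_le (fun z : int => (z%:~R, z%:~R) : R * R) _).
    by apply: subset_card_le => _ [z ->]; exists z.
  + by move=> _ _ [m ->] [n ->]; exists (m - n); rewrite intrB.
  + move=> [z [H _]].
    have : (1 : int)%:~R = (z * 2)%:~R :> R by rewrite intrM -H mulVf.
    move=> /intr_inj; lia.
- move=> x; rewrite !inE => /orP[]/eqP ->; rewrite lexx ler01 //.
- have [_ _ m1] := near_uniform_cst R 0 (lexx 0).
  move=> x; rewrite !inE => /orP[]/eqP ->; first by exists 0; rewrite mass0.
  by exists 1; rewrite m1.
Qed.

(** Iterating [adversary_reply] yields an infinite run: [h k] is the transcript so far, each reply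
    being computed with the density chosen after seeing the query. Once the protocol stops, the
    transcript stays constant. *)
Lemma adversary_run (R : realType) (n : nat) cut (P : protocol R n) :
  cut_oracle cut ->
  exists (h : nat -> seq (answer R)) (f : nat -> R -> R) (D : nat -> seq R)
      (G : nat -> set (R * R)),
    h 0%N = [::] /\
    forall k, [/\ adversary (tolerance k) (f k) (D k) (G k),
      refines (tolerance k) (f k) (D k) (tolerance k.+1) (f k.+1) (D k.+1),
      forall A, P (h k) = inr A -> h k.+1 = h k &
      forall q, P (h k) = inl q ->
        h k.+1 = rcons (h k) (market_reply cut (f k.+1) q) /\
        forall d g, d < 1 -> near_uniform d g ->
          {in D k.+1, mass g =1 mass (f k.+1)} ->
          market_reply cut g q = market_reply cut (f k.+1) q].
Proof.
move=> hcut.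
pose T : Type := (seq (answer R) * (R -> R) * seq R * set (R * R))%type.
pose hh (s : T) := s.1.1.1; pose ff (s : T) := s.1.1.2.
pose DD (s : T) := s.1.2; pose GG (s : T) := s.2.
pose valid k (s : T) := adversary (tolerance k) (ff s) (DD s) (GG s).
pose next k (s s' : T) := [/\ valid k.+1 s',
  refines (tolerance k) (ff s) (DD s) (tolerance k.+1) (ff s') (DD s'),
  forall A, P (hh s) = inr A -> hh s' = hh s &
  forall q, P (hh s) = inl q ->
    hh s' = rcons (hh s) (market_reply cut (ff s') q) /\
    forall d g, d < 1 -> near_uniform d g -> {in DD s', mass g =1 mass (ff s')} ->
      market_reply cut g q = market_reply cut (ff s') q].
(* Validity is put inside the existential, with a dummy successor for invalid states, so that choice
   gives a total step function. *)
have stepP (ks : nat * T) : exists s', valid ks.1 ks.2 -> next ks.1 ks.2 s'.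
  case: ks => k s /=; case: (pselect (valid k s)) => [vs|nvs]; last by exists s.
  have tk := tolerance_gt0 R k.
  case Ps : (P (hh s)) => [q|A].
    have [f' [D' [G' [sf rf Hq]]]] :=
      adversary_reply _ _ _ _ _ _ _ q hcut vs tk (tolerance_le _ _).
    exists (rcons (hh s) (market_reply cut f' q), f', D', G') => _.
    by rewrite /next /valid /= toleranceS Ps; split => // q' [<-].
  exists s => _; rewrite /next /valid toleranceS Ps.
  have t4 : tolerance k / 4 <= tolerance k :> R by lra.
  by split => //; [exact: adversary_le vs | exact: refines_refl].
have [F HF] := choice stepP.
pose s0 : T := ([::], fun=> 1, [:: 0; 1],
  [set g : R * R | exists z : int, g = (z%:~R, z%:~R)]).
pose s := fix s k := if k is j.+1 then F (j, s j) else s0.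
have vs k : valid k (s k).
  elim: k => [|k IH]; first exact: adversary_start.
  by case: (HF (k, s k) IH).
exists (hh \o s), (ff \o s), (DD \o s), (GG \o s); split => // k.
have [_ rk stopk askk] := HF (k, s k) (vs k).
by split; [exact: vs | exact: rk | exact: stopk | exact: askk].
Qed.

Lemma outputs_inj (R : realType) (n : nat) (P : protocol R n) ans h A B :
  outputs P ans h A -> outputs P ans h B -> A = B.
Proof.
elim=> {}h => [{}A PA oB|q {}A Pq _ IH oB].
  by case: oB PA => [{}h {}B -> [->]|{}h q {}B -> _].
by case: oB Pq IH => [{}h {}B -> //|{}h q' {}B -> oB [<-]]; exact.
Qed.

(* The limit of the adversary's densities: on this single instance the protocol
   must halt, and what it knows then is the mass of the points of [D]. *)
Lemma fooling_density (R : realType) (n : nat) cut (P : protocol R n) :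
  cut_oracle cut -> exists2 f : R -> R, near_uniform 2^-1 f &
  forall A, outputs P (market_reply cut f) [::] A ->
  exists (D : seq R) (G : set (R * R)), [/\ halving_free G,
    {in D, forall x : R, 0 <= x <= 1},
    0 \in D /\ 1 \in D, {in D, forall x, G (x, mass f x)} &
    forall d g, d < 1 -> near_uniform d g -> {in D, mass g =1 mass f} ->
      outputs P (market_reply cut g) [::] A].
Proof.
move=> hcut; have [h [f [D [G [h0 run]]]]] := adversary_run _ _ _ P hcut.
have [||g gf] := uniform_limit _ tolerance f.
- by move=> k; exact/ltW/tolerance_gt0.
- by move=> k x; have [_ rk _ _] := run k; exact: refines_dist rk x.
have nf k : near_uniform 2^-1 (f k).
  have [sk _ _ _] := run k; apply: near_uniform_le (adversary_density _ _ _ _ sk).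
  by rewrite gerBl; exact/ltW/tolerance_gt0.
have [ng mg] := near_uniform_limit _ _ _ _ _ (cvg_tolerance R) gf nf.
have stable k j : (k <= j)%N ->
    {subset D k <= D j} /\ {in D k, mass (f j) =1 mass (f k)}.
  move=> /subnK <-; elim: (j - k)%N => [|i [IHs IHm]]; rewrite ?add0n ?addSn; first by split.
  have [_ [_ rm rs] _ _] := run (i + k)%N.
  split=> [x xD|x xD]; first exact/rs/IHs.
  by rewrite rm ?IHm // IHs.
have gD k : {in D k, mass g =1 mass (f k)}.
  move=> x xD; have [sk _ _ _] := run k.
  apply: (mg k); first exact: adversary_cake sk _ xD.
  by move=> j kj; case: (stable k j kj) => _; exact.
exists g => // A; rewrite -h0.
(* On the limit [g] the protocol receives the adversary's replies, so its halting computation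
   follows the transcripts [h] and one of them must be final. *)
have halts k : outputs P (market_reply cut g) (h k) A ->
    exists j, P (h j) = inr A.
  move ehk : (h k) => hk o; elim: o k ehk => {}hk => [{}A PA k ehk|q {}A Pq _ IH k ehk].
    by exists k; rewrite ehk.
  apply: (IH k.+1).
  have [_ _ _ /(_ q)] := run k; rewrite ehk => /(_ Pq)[-> Hq].
  have lt1 : 2^-1 < 1 :> R by lra.
  by rewrite -(Hq _ _ lt1 ng (gD _)).
move=> /halts[k Pk]; have [sk _ _ _] := run k.
exists (D k), (G k); split.
- exact: adversary_group sk.
- exact: adversary_cake sk.
- by split; [exact: adversary_zero sk | exact: adversary_one sk].
- by move=> x xD; rewrite (gD k) //; exact: adversary_points sk _ xD.
move=> d g' d1 ng' g'g.
(* Any [g'] with the same masses on [D k] reproduces the transcripts: going backwards from the final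
   one, each [D j] with [j <= k] is included in [D k], so each earlier reply agrees as well. *)
suff H i : (i <= k)%N -> outputs P (market_reply cut g') (h (k - i)%N) A.
  by have := H k (leqnn k); rewrite subnn.
elim: i => [|i IH] ik; first by rewrite subn0; exact: outputs_stop.
have := IH (ltnW ik); rewrite subnS; set j := (k - i)%N.
have j0 : (0 < j)%N by rewrite subn_gt0.
have jk : (j <= k)%N by exact: leq_subr.
have [_ _ stopj askj] := run j.-1; rewrite prednK // in stopj askj.
case Pj : (P (h j.-1)) => [q|B]; last by rewrite -(stopj _ Pj).
have [-> Hq] := askj _ Pj; move=> o; apply: outputs_query Pj _.
rewrite (Hq _ _ d1 ng') // => x xD.
have [sjk mjk] := stable j k jk.
by rewrite g'g ?sjk // (gD k) ?sjk // mjk.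
Qed.

(** * Two agents with uniform utilities *)

Definition uniform_agents {R : realType} {n : nat} (f : R -> R)
    (df : density f) : instance R n :=
  Instance (fun _ : 'I_n =>
    near_uniform_density R 0 _ ler01 (near_uniform_cst R 0 (lexx 0))) df.

Lemma reply_uniform_agents (R : realType) (n : nat) cut (f : R -> R)
    (df : density f) :
  reply cut (uniform_agents f df : instance R n) = market_reply cut f.
Proof. by apply/funext => -[[i|] x y x0 xy y1|[i|] x b x0 x1 b0]. Qed.

Lemma allocation_piece (R : realType) (n : nat) (A : 'I_n -> set R) i :
  is_allocation A -> piece (A i).
Proof.
by move=> [mA cA _]; split; [exact: mA | rewrite -cA => x Ax; exists i].
Qed.

(** The two shares cover the cake and overlap in a null set, so their values add up to 1. *)
Lemma value_half (R : realType) (f : R -> R) (A : 'I_2 -> set R) :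
  is_allocation A -> bounded_measurable f -> value f cake = 1 ->
  value f (A ord0) = value f (A ord_max) -> value f (A ord0) = 2^-1.
Proof.
move=> aA bf f1 e; have [mA cA A0] := aA.
have p0 := allocation_piece _ _ _ ord0 aA.
have p1 := allocation_piece _ _ _ ord_max aA.
have := value_split _ _ _ _ bf (piece_cake R) p0.1.
have := value_split _ _ _ _ bf p1 p0.1.
rewrite (value_null _ _ (A ord_max `&` A ord0)) //; last 2 first.
- exact: pieceI p1 p0.1.
- by rewrite /len A0.
have -> : cake `&` A ord0 = A ord0 by rewrite setIC; exact/setIidPl/p0.2.
have -> : cake `\` A ord0 = A ord_max `\` A ord0.
  apply/seteqP; split => x [] Ax Nx; split => //; last exact: p1.2.
  move: Ax; rewrite -cA => -[i _ Aix].
  have [i0|i1] : i = ord0 \/ i = ord_max.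
    by case: i {Aix} => -[|[|//]] Hi; [left|right]; apply: val_inj.
  - by case: Nx; rewrite -i0.
  - by rewrite -i1.
by rewrite f1 -e; lra.
Qed.

Theorem mainTheorem13 (R : realType)
    (cut : (R -> R) -> R -> R -> answer R) (hcut : cut_oracle cut) :
  ~ exists P : forall n : nat, protocol R n,
      forall (n : nat) (I : instance R n), (0 < n)%N ->
        exists A : 'I_n -> set R,
          [/\ outputs (P n) (reply cut I) [::] A,
              is_allocation A,
              envy_free I A
            & market_envy_free I A].
Proof.
move=> [P HP].
have [f nf Hf] := fooling_density _ _ _ (P 2%N) hcut.
have solve d g : d < 1 -> near_uniform d g ->
    exists A, [/\ outputs (P 2%N) (market_reply cut g) [::] A,
      piece (A ord0), len (A ord0) = 2^-1 & value g (A ord0) = 2^-1].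
  move=> d1 ng; have dg := near_uniform_density _ _ _ (ltW d1) ng.
  have [A [oA aA eA mA]] := HP 2%N (uniform_agents g dg) isT.
  rewrite reply_uniform_agents in oA.
  have p0 := allocation_piece _ _ _ ord0 aA.
  exists A; split => //.
    rewrite -[LHS]mul1r -value_cst //; apply: value_half => //.
    - exact: bounded_measurable_cst.
    - by have [_ _] := near_uniform_cst R 0 (lexx 0).
    (* With uniform utilities, absence of envy in both directions means equal lengths. *)
    - by apply/eqP; rewrite eq_le; apply/andP; split; exact: (eA _ _).
  apply: value_half => //.
  - exact: near_uniform_bounded ng.
  - by case: ng.
have h1 : 2^-1 < 1 :> R by lra.
(* The margin [4^-1] leaves room to tilt the limit density while keeping the bound below 1, where
   cut replies are unique. *)
have q1 : 2^-1 + 4^-1 < 1 :> R by lra.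
have [A [oA pA lA _]] := solve _ _ h1 nf.
have [D [G [hG D01 [D0 D1] DG same]]] := Hf _ oA.
have q0 : 0 < 4^-1 :> R by lra.
apply: (no_robust_halving _ _ _ _ _ _ _ nf q0 hG D01 D0 D1 DG pA lA) => g ng gD.
(* The protocol halves [g] with some share, and since [g] agrees with [f] on [D] the output on [g]
   is the allocation [A] found for [f]. *)
have [B [oB _ _ <-]] := solve _ _ q1 ng.
by rewrite (outputs_inj _ _ _ _ _ _ _ (same _ _ q1 ng gD) oB).
Qed.
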